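(* Let $p$ be an odd prime. For each positive integer $n$ write $H_n=1+\frac12+\cdots+\frac1n=c_n/d_n$ in lowest terms, let $D_n=\mathrm{lcm}(1,2,\ldots,n)$, and let $q_n=D_n/d_n$. Define $\mathcal{E}_p=\{n: 1<n<p,\ p\mid c_n\}$ and $\mathcal{Q}_p=\{n\ge1: p\mid q_n\}$. Then $\mathcal{Q}_p$ has a harmonic density, namely \[\delta(\mathcal{Q}_p)=\lim_{x\to\infty}\frac{1}{\log x}\sum_{n\le x,\ n\in\mathcal{Q}_p}\frac1n=\frac{1}{\log p}\sum_{m\in\mathcal{E}_p}\log\Big(1+\frac1m\Big),\] where in particular the limit exists.
   Context: $H_n=c_n/d_n$ with $\gcd(c_n,d_n)=1$; $D_n=\mathrm{lcm}(1,\ldots,n)$; $q_n=D_n/d_n$. The harmonic density of a set $\mathcal{A}$ of positive integers is $\lim_{x\to\infty}\frac{1}{\log x}\sum_{n\le x,\,n\in\mathcal{A}}\frac1n$, when this limit exists. *)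

(* Defs.v *)
From HB Require Import structures.
From mathcomp Require Import all_boot all_order all_algebra.
From mathcomp Require Import all_classical all_reals all_analysis.

Set Implicit Arguments.
Unset Strict Implicit.
Unset Printing Implicit Defensive.

Import Order.TTheory GRing.Theory Num.Theory.
Import numFieldNormedType.Exports.

Local Open Scope classical_set_scope.
Local Open Scope ring_scope.

Definition harmonic_number (n : nat) : rat := \sum_(1 <= i < n.+1) i%:R^-1.

(* [numq] and [denq] are the coprime numerator and positive denominator. *)
Definition harmonic_num (n : nat) : int := numq (harmonic_number n).

Definition harmonic_den (n : nat) : int := denq (harmonic_number n).

Definition lcm_upto (n : nat) : nat := (\big[lcmn/1]_(1 <= i < n.+1) i)%N.

(* The Euclidean quotient is exact, by [harmonic_den_dvd] below. *)
Definition lcm_quotient (n : nat) : int :=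
  ((lcm_upto n)%:Z %/ harmonic_den n)%Z.

Lemma harmonic_den_dvd (n : nat) : (harmonic_den n %| (lcm_upto n)%:Z)%Z.
Proof.
pose D := (lcm_upto n)%:Z.
have [m Dm] : exists m : int, D%:~R * harmonic_number n = m%:~R :> rat.
  rewrite /harmonic_number mulr_sumr.
  exists (\sum_(1 <= i < n.+1) (lcm_upto n %/ i)%N%:Z).
  rewrite rmorph_sum /= big_nat_cond [RHS]big_nat_cond.
  apply: eq_bigr => i; rewrite andbT => /andP[i_gt0 i_le_n].
  have iD : (i %| lcm_upto n)%N.
    by rewrite /lcm_upto (bigD1_seq i) ?mem_index_iota ?i_gt0 ?iota_uniq //=
      dvdn_lcml.
  have i_neq0 : i%:R != 0 :> rat by rewrite pnatr_eq0 -lt0n.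
  by rewrite /D -{1}(divnK iD) PoszM intrM /= !pmulrn mulfK -?pmulrn.
have Dnd : D * harmonic_num n = m * harmonic_den n.
  apply: (@intr_inj rat); rewrite !intrM -Dm -mulrA; congr (_ * _).
  by rewrite /harmonic_num numqE.
rewrite -(@Gauss_dvdzl _ _ (harmonic_num n)).
  by rewrite Dnd dvdz_mull.
by rewrite /coprimez gcdzC; apply: coprime_num_den.
Qed.

Definition E_set (p : nat) : set nat :=
  [set n | (1 < n < p)%N /\ (p%:Z %| harmonic_num n)%Z].

Definition Q_set (p : nat) : set nat :=
  [set n | (1 <= n)%N /\ (p%:Z %| lcm_quotient n)%Z].

(* For natural [n] and real [x >= 0], [n <= x] iff [n < (Num.truncn x).+1]. *)
Definition harmonic_average (R : realType) (A : set nat) (x : R) : R :=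
  (ln x)^-1 * \sum_(1 <= n < (Num.truncn x).+1 | n \in A) n%:R^-1.

Definition has_harmonic_density (R : realType) (A : set nat) : Prop :=
  cvg (harmonic_average A x @[x --> (+oo : set_system R)]).

(* Meaningful only under [has_harmonic_density R A]. *)
Definition harmonic_density (R : realType) (A : set nat) : R :=
  lim (harmonic_average A x @[x --> (+oo : set_system R)]).

(* Main.v *)
Require Import Defs.
From HB Require Import structures.
From mathcomp Require Import all_boot all_order all_algebra.
From mathcomp Require Import all_classical all_reals all_analysis.
From mathcomp Require Import ring lra zify.

Set Implicit Arguments.
Unset Strict Implicit.
Unset Printing Implicit Defensive.

Import Order.TTheory GRing.Theory Num.Theory.
Import numFieldNormedType.Exports.

Local Open Scope classical_set_scope.
Local Open Scope ring_scope.

(* Write N = \sum_(i <= n) D_n / i, so that q_n = gcd (D_n, N).  If m is the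
   leading base-p digit of n and p ^ k <= n < p ^ k.+1, then D_n = D * p ^ k
   with p prime to D, and modulo p only the terms of N with i = j * p ^ k
   survive; hence N = \sum_(j <= m) D / j modulo p, and n is in Q_p iff k > 0
   and m is in E_p.  Replacing the weight 1 / n by ln (1 + 1 / n) changes the sum
   over any set of positive integers by at most 1, since the differences are
   nonnegative and dominated by the telescoping 1 / n - 1 / n.+1.  With the new
   weights the integers with leading digit m between p ^ k and p ^ k.+1
   contribute exactly ln (1 + 1 / m), so each scale k > 0 contributes the same
   amount \sum_(m in E_p) ln (1 + 1 / m), over a length ln p of the variable
   ln x. *)

(** * Clearing denominators in harmonic sums *)

Lemma harmonic_num_mul (D n : nat) :
    (forall i, (0 < i <= n)%N -> (i %| D)%N) ->
  D%:Z * harmonic_num n =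
    (\sum_(1 <= i < n.+1) D %/ i)%N%:Z * harmonic_den n.
Proof.
move=> dvdD; apply: (@intr_inj rat); rewrite !intrM.
suff <- : D%:Z%:~R * harmonic_number n
    = (\sum_(1 <= i < n.+1) D %/ i)%N%:Z%:~R :> rat.
  by rewrite -mulrA; congr (_ * _); rewrite /harmonic_num numqE.
rewrite /harmonic_number mulr_sumr -!pmulrn natr_sum.
apply: eq_big_nat => i; rewrite ltnS => i_range.
have i_neq0 : i%:R != 0 :> rat by rewrite pnatr_eq0; lia.
by rewrite -{1}(divnK (dvdD i i_range)) natrM mulfK.
Qed.

Lemma dvd_lcm_upto (n i : nat) : (0 < i <= n)%N -> (i %| lcm_upto n)%N.
Proof.
move=> i_range; rewrite /lcm_upto (bigD1_seq i) ?iota_uniq ?dvdn_lcml //=.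
by rewrite mem_index_iota ltnS.
Qed.

Lemma lcm_upto_gt0 (n : nat) : (0 < lcm_upto n)%N.
Proof.
rewrite /lcm_upto big_seq; apply: (big_ind (fun x => 0 < x)%N) => //.
  by move=> x y x0 y0; rewrite lcmn_gt0 x0.
by move=> i; rewrite mem_index_iota => /andP[].
Qed.

Lemma sum_nat_dvdn (q n : nat) (F : nat -> nat) : (0 < q)%N ->
  (\sum_(1 <= i < n.+1 | q %| i) F i = \sum_(1 <= j < (n %/ q).+1) F (j * q))%N.
Proof.
move=> q_gt0; elim: n => [|n IHn]; first by rewrite div0n !big_geq.
rewrite big_mkcond big_nat_recr //= -big_mkcond IHn divnS //=.
case: ifP => [qn|_]; last by rewrite addn0.
rewrite add1n [RHS]big_nat_recr //=; congr (_ + F _)%N.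
by rewrite -[LHS](divnK qn) divnS // qn.
Qed.

(** * Valuations at [p] and the leading base-[p] digit *)

Section PrimeDivisor.
Variables (p : nat) (p_prime : prime p).

Lemma prime_ndvd_coprime (m n : nat) :
  coprime m n -> (p %| m)%N -> ~~ (p %| n)%N.
Proof.
by move=> mn pm; rewrite -prime_coprime //; apply: coprime_dvdl mn.
Qed.

(** The power [p ^ k] is itself an entry of the lcm, and an entry [i] of valuation [v] satisfies
    [p ^ v <= i < p ^ k.+1]. *)
Lemma logn_lcm_upto (n k : nat) :
  (p ^ k <= n < p ^ k.+1)%N -> logn p (lcm_upto n) = k.
Proof.
move=> /andP[le_n n_lt]; apply/eqP; rewrite eqn_leq; apply/andP; split;
  last first.
  rewrite -pfactor_dvdn ?lcm_upto_gt0 //; apply: dvd_lcm_upto.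
  by rewrite expn_gt0 prime_gt0.
suff /andP[_] : (0 < lcm_upto n)%N && (logn p (lcm_upto n) <= k)%N by [].
rewrite /lcm_upto big_seq.
apply: (big_ind (fun x => (0 < x) && (logn p x <= k))%N) => [|x y|i].
- by rewrite logn1.
- move=> /andP[x0 xk] /andP[y0 yk]; rewrite lcmn_gt0 x0 y0 logn_lcm //.
  by rewrite geq_max xk.
rewrite mem_index_iota ltnS => /andP[i0 i_le]; rewrite i0 /=.
rewrite -ltnS -(ltn_exp2l _ _ (prime_gt1 p_prime)).
apply: leq_ltn_trans n_lt; apply: leq_trans i_le.
by rewrite dvdn_leq // pfactor_dvdnn.
Qed.

(** In [D * c = N * d], [p] is prime to [D], and also to [d] as soon as it divides [c]. This is
    applied to a leading digit [n], with [D] the prime-to-[p] part of a larger lcm. *)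
Lemma dvdz_harmonic_num (D n : nat) :
    (forall i, (0 < i <= n)%N -> (i %| D)%N) -> ~~ (p %| D)%N ->
  (p%:Z %| harmonic_num n)%Z = (p %| \sum_(1 <= i < n.+1) D %/ i)%N.
Proof.
move=> /harmonic_num_mul /(congr1 absz); rewrite !abszM !absz_nat.
set N := (\sum_(1 <= i < n.+1) D %/ i)%N => DcNd pD.
have cop : coprime `|harmonic_num n| `|harmonic_den n| := coprime_num_den _.
rewrite dvdzE absz_nat; apply/idP/idP => pdvd.
  have : (p %| N * `|harmonic_den n|)%N by rewrite -DcNd dvdn_mull.
  by rewrite Euclid_dvdM // (negbTE (prime_ndvd_coprime cop pdvd)) orbF.
have : (p %| D * `|harmonic_num n|)%N by rewrite DcNd dvdn_mulr.
by rewrite Euclid_dvdM // (negbTE pD).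
Qed.

(** Cancelling [d] gives [D = q * d] and [N = q * c] for the sum [N]; a prime dividing both must
    divide [q], because [c] and [d] are coprime. *)
Lemma dvdz_lcm_quotient (n : nat) (D := lcm_upto n) :
  (p%:Z %| lcm_quotient n)%Z =
    (p %| D)%N && (p %| \sum_(1 <= i < n.+1) D %/ i)%N.
Proof.
have /divzK := harmonic_den_dvd n; rewrite -/(lcm_quotient n).
move: (lcm_quotient n) => q qd.
have d_neq0 : harmonic_den n != 0 by apply: denq_neq0.
have := harmonic_num_mul (@dvd_lcm_upto n); rewrite -qd -/D.
rewrite mulrAC => /(mulIf d_neq0) /(congr1 absz).
move: qd => /(congr1 absz); rewrite !abszM !absz_nat -/D.
set N := (\sum_(1 <= i < n.+1) D %/ i)%N => qd qc.
have cop : coprime `|harmonic_num n| `|harmonic_den n| := coprime_num_den _.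
rewrite dvdzE absz_nat -qd -qc; apply/idP/andP => [pq|[]].
  by rewrite !dvdn_mulr.
rewrite !Euclid_dvdM //; case: (p %| `|q|)%N => //= pd pc.
by have := prime_ndvd_coprime cop pc; rewrite pd.
Qed.

(** If [p] does not divide the quotient of [D * p ^ k] by [i], then [p ^ k] divides [i]. In the
    remaining terms [i = j * p ^ k], the power cancels. *)
Lemma sum_divn_mod (n k D : nat) :
    (forall i, (0 < i <= n)%N -> (i %| D * p ^ k)%N) ->
  (\sum_(1 <= i < n.+1) (D * p ^ k) %/ i
     = \sum_(1 <= j < (n %/ p ^ k).+1) D %/ j %[mod p])%N.
Proof.
move=> dvdD; have pk_gt0 : (0 < p ^ k)%N by rewrite expn_gt0 prime_gt0.
rewrite (bigID (fun i => p ^ k %| i)%N) /= sum_nat_dvdn //.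
under eq_bigr do rewrite divnMr //.
rewrite -modnDmr; suff /eqP -> :
    (p %| \sum_(1 <= i < n.+1 | ~~ (p ^ k %| i)) (D * p ^ k) %/ i)%N.
  by rewrite addn0.
rewrite big_nat_cond; apply: dvdn_sum => i /andP[]; rewrite ltnS => i_range.
apply: contraR => pNf; have /divnK := dvdD i i_range.
move=> Di; have : (p ^ k %| (D * p ^ k) %/ i * i)%N by rewrite Di dvdn_mull.
by rewrite Gauss_dvdr // coprimeXl // prime_coprime.
Qed.

Lemma Q_setP (n k m : nat) : (0 < m < p)%N ->
    (m * p ^ k <= n < m.+1 * p ^ k)%N ->
  (n \in Q_set p) = (0 < k)%N && (m \in E_set p).
Proof.
move=> /andP[m_gt0 m_lt] /andP[le_n n_lt].
have pk_gt0 : (0 < p ^ k)%N by rewrite expn_gt0 prime_gt0.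
have n_gt0 : (0 < n)%N by rewrite (leq_trans _ le_n) // muln_gt0 m_gt0.
have n_div : (n %/ p ^ k = m)%N.
  by apply/eqP; rewrite eqn_leq -ltnS ltn_divLR // n_lt leq_divRL.
have D_gt0 := lcm_upto_gt0 n.
have lognD : logn p (lcm_upto n) = k.
  apply: logn_lcm_upto => //; rewrite (leq_trans _ le_n) ?leq_pmull //=.
  by rewrite (leq_trans n_lt) // expnS leq_mul.
have [D pD DE] := pfactor_coprime p_prime D_gt0; rewrite lognD in DE.
rewrite prime_coprime // in pD.
have dvd_m i : (0 < i <= m)%N -> (i %| D)%N.
  move=> /andP[i_gt0 i_le].
  have : (i %| D * p ^ k)%N.
    rewrite -DE dvd_lcm_upto // i_gt0 /= (leq_trans i_le) //.
    by rewrite (leq_trans _ le_n) // leq_pmulr.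
  (* Since [0 < i <= m < p], [i] is prime to [p ^ k]. *)
  rewrite Gauss_dvdl // coprime_sym coprimeXl // prime_coprime // gtnNdvd //.
  exact: leq_ltn_trans m_lt.
have p_lcm : (p %| lcm_upto n)%N = (0 < k)%N.
  by rewrite -[X in (X %| _)%N]expn1 pfactor_dvdn // lognD.
have p_E : (p%:Z %| harmonic_num m)%Z =
    (p %| \sum_(1 <= i < n.+1) lcm_upto n %/ i)%N.
  rewrite (dvdz_harmonic_num dvd_m) // DE /dvdn sum_divn_mod ?n_div //.
  by rewrite -DE; exact: dvd_lcm_upto.
apply/idP/andP => [/set_mem[_]|[k_gt0 /set_mem[_ pm]]].
  rewrite dvdz_lcm_quotient // p_lcm -p_E => /andP[-> pm]; split=> //.
  apply/mem_set; split=> //; rewrite m_lt andbT.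
  (* [E_set] requires [1 < m]; the digit 1 is ruled out because the first harmonic number has
     numerator 1. *)
  move: pm; case: m m_gt0 {m_lt le_n n_lt n_div dvd_m p_E} => [|[|m]] //= _.
  rewrite /harmonic_num /harmonic_number big_nat1 invr1 dvdzE absz_nat.
  by rewrite dvdn1 => /eqP pe; have := prime_gt1 p_prime; rewrite pe.
apply/mem_set; split=> //.
by rewrite dvdz_lcm_quotient // p_lcm -p_E k_gt0.
Qed.

End PrimeDivisor.

(** * Comparison of the weights 1 / n and ln (1 + 1 / n) *)

Section LogarithmicWeights.
Variable R : realType.
Implicit Types (P : pred nat) (n N : nat).

Lemma ln1DV_ge0 n : 0 <= ln (1 + n%:R^-1 : R).
Proof. by rewrite ln_ge0 // lerDl invr_ge0 ler0n. Qed.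

Lemma sum_ln1DV (a b : nat) : (0 < a <= b)%N ->
  \sum_(a <= n < b) ln (1 + n%:R^-1 : R) = ln b%:R - ln a%:R.
Proof.
move=> /andP[a_gt0 a_le]; rewrite -(telescope_sumr (fun n => ln (n%:R : R))) //.
apply: eq_big_nat => n /andP[a_n _]; have n_gt0 : (0 < n)%N by lia.
rewrite -ln_div ?posrE ?ltr0n //; congr (ln _).
by rewrite -natr1 mulrDl divff ?mul1r // pnatr_eq0 -lt0n.
Qed.

Lemma sum_nat_subset_le P (F : nat -> R) (a b c : nat) :
    (forall n, 0 <= F n) -> (b <= c)%N ->
  \sum_(a <= n < b | P n) F n <= \sum_(a <= n < c | P n) F n.
Proof.
move=> F_ge0 b_le; rewrite (big_nat_widen _ _ _ _ _ b_le).
rewrite big_mkcond [leRHS]big_mkcond; apply: ler_sum => n _.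
by case: (P n); case: (n < b)%N => /=.
Qed.

(** Both bounds are ln (1 + t) <= t: at t = 1 / n, and at t = - 1 / (n + 1), since 1 + 1 / n is the
    inverse of 1 - 1 / (n + 1). *)
Lemma invn_sub_ln_bound n : (0 < n)%N ->
  0 <= n%:R^-1 - ln (1 + n%:R^-1 : R) <= n%:R^-1 - n.+1%:R^-1.
Proof.
move=> n_gt0; have nR_gt0 : 0 < n%:R :> R by rewrite ltr0n.
have nS_gt0 : 0 < n.+1%:R :> R by rewrite ltr0n.
have nV_gt0 : 0 < n%:R^-1 :> R by rewrite invr_gt0.
apply/andP; split.
  by rewrite subr_ge0 le_ln1Dx // (lt_trans _ nV_gt0) ?ltrN10.
rewrite lerD2l lerN2 -[leRHS]opprK lerNr -lnV ?posrE ?addr_gt0 //.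
have -> : (1 + n%:R^-1 : R)^-1 = 1 + (- n.+1%:R^-1).
  rewrite -natr1; field.
  by rewrite natr1 !gt_eqF.
by rewrite le_ln1Dx // ltrN2 invf_lt1 // ltr1n.
Qed.

Lemma sum_invn_bound P N :
  0 <= \sum_(1 <= n < N | P n) (n%:R^-1 : R)
         - \sum_(1 <= n < N | P n) ln (1 + n%:R^-1 : R) <= 1.
Proof.
rewrite -sumrB; apply/andP; split.
  rewrite big_nat_cond; apply: sumr_ge0 => n /andP[/andP[n_gt0 _] _].
  by have /andP[] := invn_sub_ln_bound n_gt0.
apply: (@le_trans _ _ (\sum_(1 <= n < N) (n%:R^-1 - n.+1%:R^-1 : R))).
  rewrite big_mkcond big_nat_cond [leRHS]big_nat_cond.
  apply: ler_sum => n /andP[/andP[n_gt0 _] _].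
  have /andP[ge0 le] := invn_sub_ln_bound n_gt0.
  by case: (P n) => //; exact: le_trans le.
under eq_bigr do rewrite -opprB.
have [N_le1|N_gt1] := leqP N 1; first by rewrite big_geq.
rewrite sumrN telescope_sumr ?(ltnW N_gt1) // invr1 opprB.
by rewrite lerBlDr lerDl invr_ge0 ler0n.
Qed.

End LogarithmicWeights.

(** * Contribution of each scale, and the limit *)

Section Density.
Variables (R : realType) (p : nat) (p_prime : prime p).

Let S : R := \sum_(0 <= m < p | m \in E_set p) ln (1 + m%:R^-1).

Lemma sum_E_ge0 : 0 <= S.
Proof. by apply: sumr_ge0 => m _; exact: ln1DV_ge0. Qed.

(** Induction on the bound [M] for the leading digit: over the integers with digit [m] the
    logarithms telescope to ln ((m + 1) / m), whatever [k] is. The full scale is [M = p]. *)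
Lemma sum_Q_block (k M : nat) : (0 < k)%N -> (0 < M <= p)%N ->
  \sum_(p ^ k <= n < M * p ^ k | n \in Q_set p) ln (1 + n%:R^-1 : R) =
  \sum_(0 <= m < M | m \in E_set p) ln (1 + m%:R^-1).
Proof.
move=> k_gt0; have pk_gt0 : (0 < p ^ k)%N by rewrite expn_gt0 prime_gt0.
elim: M => [//|[_ _|M IHM M_lt]].
  (* The left range is empty, and the only index on the right, 0, is outside [E_set]. *)
  rewrite mul1n big_geq // big_mkcond big_nat1 ifF //.
  by apply/negP => /set_mem[].
rewrite (@big_cat_nat _ _ _ (M.+1 * p ^ k)) ?leq_pmull ?leq_mul //=.
rewrite IHM; last lia.
rewrite [RHS]big_mkcond big_nat_recr //= -big_mkcond; congr (_ + _).
have inQ n : (M.+1 * p ^ k <= n < M.+2 * p ^ k)%N ->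
    (n \in Q_set p) = (M.+1 \in E_set p).
  by move=> n_range; rewrite (Q_setP p_prime _ n_range) ?k_gt0.
rewrite big_mkcond.
under eq_big_nat => n n_range do rewrite inQ //.
case: (M.+1 \in E_set p); last by rewrite big1.
rewrite sum_ln1DV ?leq_mul ?muln_gt0 ?pk_gt0 //.
rewrite -ln_div ?posrE ?ltr0n ?muln_gt0 ?pk_gt0 //; congr (ln _).
rewrite !natrM -natr1; field.
by rewrite nat1r !pnatr_eq0 -!lt0n.
Qed.

(** Of the [K] scales below [p ^ K], scale 0 contributes nothing, whence the predecessor. *)
Lemma sum_Q_expn (K : nat) :
  \sum_(1 <= n < p ^ K | n \in Q_set p) ln (1 + n%:R^-1 : R) = K.-1%:R * S.
Proof.
elim: K => [|[_|K IHK]]; first by rewrite big_geq // mul0r.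
  rewrite mul0r big_nat_cond big1 // => n /andP[n_range].
  by rewrite (@Q_setP p p_prime n 0 n) // expn0 !muln1 leqnn ltnSn.
rewrite (@big_cat_nat _ _ _ (p ^ K.+1)) ?expn_gt0 ?(prime_gt0 p_prime) //=;
  last first.
  by rewrite leq_exp2l ?prime_gt1.
rewrite IHK (expnS p K.+1) sum_Q_block ?(prime_gt0 p_prime) ?leqnn //=.
by rewrite -natr1 mulrDl mul1r.
Qed.

Lemma Q_harmonic_average_dist (x : R) : 1 < x ->
  `|(ln p%:R)^-1 * S - harmonic_average (Q_set p) x| <= (2 * S + 1) / ln x.
Proof.
move=> x_gt1; have lnx_gt0 := ln_gt0 x_gt1.
have x_gt0 : 0 < x by exact: lt_trans x_gt1.
have lnp_gt0 : 0 < ln (p%:R : R) by rewrite ln_gt0 // ltr1n prime_gt1.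
have /andP[N_le N_gt] := truncn_itv (ltW x_gt0).
rewrite /harmonic_average; set N := Num.truncn x in N_le N_gt *.
have N_gt0 : (0 < N)%N.
  by rewrite -(ltr_nat R) -(ltrD2r 1) add0r natr1 (lt_trans x_gt1).
have /andP[pK_le pK_gt] := trunc_log_bounds (prime_gt1 p_prime) N_gt0.
set K := trunc_log p N in pK_le pK_gt.
have lnpX k : ln ((p ^ k)%:R : R) = k%:R * ln p%:R.
  by rewrite natrX lnXn ?ltr0n ?(prime_gt0 p_prime) // mulr_natl.
have lnx_ge : K%:R * ln p%:R <= ln x.
  rewrite -lnpX ler_ln ?posrE ?ltr0n ?expn_gt0 ?(prime_gt0 p_prime) //.
  by rewrite (le_trans _ N_le) // ler_nat.
have lnx_le : ln x <= (K%:R + 1) * ln p%:R.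
  rewrite natr1 -lnpX ler_ln ?posrE ?ltr0n ?expn_gt0 ?(prime_gt0 p_prime) //.
  by rewrite (le_trans (ltW N_gt)) // ler_nat.
have /andP[] := sum_invn_bound R (mem (Q_set p)) N.+1.
set A := \sum_(1 <= n < N.+1 | _) _^-1.
set B := \sum_(1 <= n < N.+1 | _) _ => BA AB.
(* As [p ^ K <= N < p ^ K.+1], [B] lies between the sums over the first [K] and the first [K.+1]
   scales. *)
have B_le : B <= K%:R * S.
  by rewrite -[K]/(K.+1.-1) -sum_Q_expn sum_nat_subset_le //; exact: ln1DV_ge0.
have B_ge : (K%:R - 1) * S <= B.
  apply: (@le_trans _ _ (K.-1%:R * S)).
    rewrite ler_wpM2r ?sum_E_ge0 //.
    (* For [K = 0] the truncated predecessor is 0, which still exceeds -1. *)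
    case: K {pK_le pK_gt lnx_ge lnx_le B_le} => [|K] /=.
      by rewrite sub0r lerN10.
    by rewrite -natr1 addrK.
  rewrite -sum_Q_expn sum_nat_subset_le // => [n|].
    exact: ln1DV_ge0.
  exact: leqW.
have -> : (ln p%:R)^-1 * S - (ln x)^-1 * A = (ln x / ln p%:R * S - A) / ln x.
  by field; rewrite !gt_eqF.
rewrite normrM normfV (gtr0_norm lnx_gt0) ler_pM2r ?invr_gt0 //.
have ge : K%:R * S <= ln x / ln p%:R * S.
  by rewrite ler_wpM2r ?sum_E_ge0 // ler_pdivlMr.
have le : ln x / ln p%:R * S <= (K%:R + 1) * S.
  by rewrite ler_wpM2r ?sum_E_ge0 // ler_pdivrMr.
(* The main term lies in [K S, (K + 1) S] and [A] in [(K - 1) S, K S + 1], so their difference lies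
   in [-1, 2 S]. *)
have := sum_E_ge0; rewrite ler_norml; move: ge le BA AB B_le B_ge.
set t := _ / _ * S; rewrite mulrDl mulrBl mul1r; set KS := K%:R * S.
by move=> *; lra.
Qed.

Lemma Q_harmonic_average_cvg :
  harmonic_average (Q_set p) x @[x --> (+oo : set_system R)] -->
    ((ln p%:R)^-1 * S : R).
Proof.
apply/cvgrPdist_le => e e_gt0.
have C_gt0 : 0 < 2 * S + 1 by have := sum_E_ge0; lra.
near=> x.
(* Beyond this threshold the error bound is at most [e]; the positive exponent also gives
   [1 < x]. *)
have x_gt : expR ((2 * S + 1) / e) < x by near: x; exact: nbhs_pinfty_gt.
have lnx_gt : (2 * S + 1) / e < ln x.
  by rewrite -ltr_expR lnK // posrE (lt_trans (expR_gt0 _) x_gt).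
have x_gt1 : 1 < x.
  by apply: le_lt_trans x_gt; rewrite -[leLHS]expR0 ler_expR ltW // divr_gt0.
apply: le_trans (Q_harmonic_average_dist x_gt1) _.
by rewrite ler_pdivrMr ?ln_gt0 // [leRHS]mulrC -ler_pdivrMr // ltW.
Unshelve. all: by end_near. Qed.

End Density.

Theorem theorem3 (R : realType) (p : nat) (p_prime : prime p)
    (p_odd : odd p) :
  has_harmonic_density R (Q_set p) /\
  harmonic_density R (Q_set p) =
    (ln (p%:R : R))^-1 *
      \sum_(0 <= m < p | m \in E_set p) ln (1 + m%:R^-1 : R).
Proof.
have cvgQ := @Q_harmonic_average_cvg R p p_prime.
split; first exact: cvgP cvgQ.
exact: cvg_lim cvgQ.
Qed.
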